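(* Let $\nu$ be a Lévy measure on $\mathbb R$, not identically zero, that is continuous, summable and unimodal with mode $0$, and let $\Omega=\nu(\mathbb R)$. Then the operator $L_\Delta$ on $D_\Delta$ is invertible and its inverse has the form $$L_\Delta^{-1}=-\frac1\Omega(I+T_1),$$ where the operator $T_1$ is compact in the space $D_\Delta$ of continuous functions on $\Delta$.
   Context: $\Delta=\bigcup_{k=1}^n[a_k,b_k]$ with $a_1<b_1<a_2<b_2<\dots<a_n<b_n$; $D_\Delta$ is the Banach space of continuous functions on $\Delta$ with the sup norm. A measure $\nu$ is summable if $\nu(\mathbb R)<\infty$, and continuous if it has no atoms. It is unimodal with mode $0$ if its distribution function is convex on $(-\infty,0)$ and concave on $(0,\infty)$. The operator $L_\Delta$ on $D_\Delta$ is $$L_\Delta f(x)=-\Omega f(x)+\int_\Delta f(y)\,d_y\nu(y-x),\quad x\in\Delta,$$ where $\int_\Delta f(y)\,d_y\nu(y-x)=\int_{\{u:\,x+u\in\Delta\}}f(x+u)\,\nu(du)$. This is the truncated generator of the Lévy process with Lévy measure $\nu$, no Gaussian part, and drift parameter $\gamma=\int_{|y|<1}y\,\nu(dy)$. *)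

(* Defs.v *)
From HB Require Import structures.
From mathcomp Require Import all_boot all_order all_algebra.
From mathcomp Require Import all_classical all_reals all_analysis.
From mathcomp Require Import measurable_realfun ring lra.

Set Implicit Arguments.
Unset Strict Implicit.
Unset Printing Implicit Defensive.

Import Order.TTheory GRing.Theory Num.Theory.
Import numFieldNormedType.Exports.

Local Open Scope classical_set_scope.
Local Open Scope ring_scope.

Definition interlaced (R : realType) (n : nat) (a b : 'I_n -> R) : Prop :=
  (forall k, a k < b k) /\ (forall j k : 'I_n, (j < k)%N -> b j < a k).

Definition Delta (R : realType) (n : nat) (a b : 'I_n -> R) : set R :=
  \bigcup_(k in [set: 'I_n]) `[a k, b k]%classic.

Section Delta_topology.
Variables (R : realType) (n : nat) (a b : 'I_n -> R).

Lemma Delta_bigsetU : Delta a b = \big[setU/set0]_(k < n) `[a k, b k]%classic.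
Proof.
rewrite -bigcup_seq; apply: eq_bigcupl.
by split=> // k _; rewrite /= mem_index_enum.
Qed.

Lemma compact_Delta : compact (Delta a b).
Proof.
rewrite Delta_bigsetU; apply: big_ind => [||k _].
- exact: compact0.
- exact: compactU.
- exact: segment_compact.
Qed.

Lemma compact_DeltaT : compact [set: Delta a b].
Proof.
move=> F FF _; have [] := compact_Delta (F := set_val @ F).
  by apply: (@filterE _ F) => -[x Ax] /=; exact: set_mem Ax.
move=> p [Ap Fp]; exists (SigSub (mem_set Ap)); split=> // A0 B FA0.
move=> [_ [[W oW <-] Wp] WB].
have FW : F (set_val @^-1` (set_val @` A0)).
  by apply: filterS FA0 => z A0z; exists z.
have nW : nbhs p W by apply: open_nbhs_nbhs; split.
have [_ [[z A0z <-] Wz]] := Fp _ _ FW nW.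
by exists z; split=> //; exact: WB.
Qed.

End Delta_topology.

(* Real-valued continuous functions on Delta a b, which carries the subspace
   topology of the line. *)
Definition D_Delta (R : realType) (n : nat) (a b : 'I_n -> R) : Type :=
  continuousType (Delta a b) R.
HB.instance Definition _ (R : realType) n (a b : 'I_n -> R) :=
  Choice.on (D_Delta a b).

Section D_Delta_lmod.
Variables (R : realType) (n : nat) (a b : 'I_n -> R).
Local Notation D := (D_Delta a b).
Implicit Types (f g : D) (h : Delta a b -> R).

Definition D_fun (f : D) : Delta a b -> R := f.

Definition D_pred : {pred (Delta a b -> R)} := mem [set f | continuous f].

Definition D_Sub (f : Delta a b -> R) (fP : f \in D_pred) : D :=
  mkcts (set_mem fP).

Lemma D_rect (K : D -> Type) : (forall h (Ph : h \in D_pred), K (D_Sub Ph)) ->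
  forall u, K u.
Proof.
move=> Ksub [h [[Ph1]]].
have Ph : h \in D_pred by rewrite inE.
have -> : Ph1 = set_mem Ph by [].
exact: Ksub.
Qed.

Lemma D_valP h (Ph : h \in D_pred) : D_fun (D_Sub Ph) = h.
Proof. by []. Qed.

HB.instance Definition _ := isSub.Build (Delta a b -> R) D_pred D D_rect D_valP.

Lemma D_submod : submod_closed D_pred.
Proof.
split; first by rewrite inE; exact: cst_continuous.
move=> c f g /[!inE] cf cg x.
by apply: continuousD; [apply: continuousM; [exact: cst_continuous|exact: cf]|exact: cg].
Qed.
HB.instance Definition _ := GRing.isSubmodClosed.Build _ _ D_pred D_submod.
HB.instance Definition _ := [SubChoice_isSubLmodule of D by <:].

Definition sup_norm (f : D) : R := sup [set `|f x| | x in [set: Delta a b]].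

Lemma has_ubound_D (f : D) : has_ubound [set `|f x| | x in [set: Delta a b]].
Proof.
have /compact_bounded[M [Mr fM]] : compact [set `|f x| | x in [set: Delta a b]].
  apply: continuous_compact; last exact: compact_DeltaT.
  apply: continuous_subspaceT => x.
  by apply: continuous_comp; [exact: cts_fun|exact: norm_continuous].
exists (M + 1) => y fy; apply: le_trans (ler_norm y) _.
by apply: fM fy; rewrite ltrDl.
Qed.

Lemma sup_norm_ub (f : D) (x : Delta a b) : `|f x| <= sup_norm f.
Proof. by apply: ub_le_sup; [exact: has_ubound_D|exists x]. Qed.

Lemma sup_norm_le (f : D) (M : R) : 0 <= M -> (forall x, `|f x| <= M) ->
  sup_norm f <= M.
Proof.
move=> M0 fM; rewrite /sup_norm.
have [->|/set0P fn0] := eqVneq [set `|f x| | x in [set: Delta a b]] set0.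
  by rewrite sup0.
by apply: ge_sup => // _ [x _ <-].
Qed.

Lemma sup_norm_ge0 (f : D) : 0 <= sup_norm f.
Proof.
rewrite /sup_norm.
have [->|/set0P[y fy]] := eqVneq [set `|f x| | x in [set: Delta a b]] set0.
  by rewrite sup0.
case: (fy) => x _ xy; apply: le_trans (sup_norm_ub f x); exact: normr_ge0.
Qed.

Lemma D_addE f g x : (f + g) x = f x + g x.
Proof. by []. Qed.

Lemma D_scaleE (c : R) f x : (c *: f) x = c * f x.
Proof. by []. Qed.

Lemma D_eqP f g : f = g <-> f =1 g.
Proof. exact: continuousEP. Qed.

Lemma ler_sup_normD f g : sup_norm (f + g) <= sup_norm f + sup_norm g.
Proof.
apply: sup_norm_le => [|x]; first by rewrite addr_ge0 ?sup_norm_ge0.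
by rewrite D_addE (le_trans (ler_normD _ _))// lerD ?sup_norm_ub.
Qed.

Lemma sup_normZ (c : R) f : sup_norm (c *: f) = `|c| * sup_norm f.
Proof.
have le d g : sup_norm (d *: g) <= `|d| * sup_norm g.
  apply: sup_norm_le => [|x]; first by rewrite mulr_ge0 ?sup_norm_ge0.
  by rewrite D_scaleE normrM ler_wpM2l ?sup_norm_ub.
apply/eqP; rewrite eq_le le/=.
have [->|c0] := eqVneq c 0; first by rewrite normr0 mul0r sup_norm_ge0.
rewrite -ler_pdivlMl ?normr_gt0// -normfV.
by rewrite -{1}[f](@scalerKV _ _ c^-1) ?invr_eq0// invrK; exact: le.
Qed.

Lemma sup_norm0_eq0 f : sup_norm f = 0 -> f = 0.
Proof.
move=> f0; apply/D_eqP => x; apply/eqP; rewrite -normr_le0 -f0.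
exact: sup_norm_ub.
Qed.

HB.instance Definition _ :=
  Lmodule_isNormed.Build R D ler_sup_normD sup_normZ sup_norm0_eq0.

Lemma D_complete (F : set_system D) : ProperFilter F -> cauchy F -> cvg F.
Proof.
move=> FF /cauchy_ballP Fc.
have ev x (f g : D) e : ball f e g -> ball (f x) e (g x).
  rewrite -!ball_normE /=; apply: le_lt_trans.
  exact: sup_norm_ub (f - g) x.
have Fx x : cvg ((fun f : D => f x) @ F).
  apply: R_complete; apply: cauchy_exP => e e0.
  have [f fF] := filter_ex (nearP_dep (Fc _ e0)).
  by exists (f x); apply: filterS fF => g; exact: ev.
pose g (x : Delta a b) : R := lim ((fun f : D => f x) @ F).
have Fg e : 0 < e -> F [set f : D | forall x, `|g x - f x| <= e].
  move=> e0; have Fe : F [set f | F (ball f e)].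
    have [[Q S] /= [FQ FS] QS] := Fc _ e0.
    apply: filterS FQ => f Qf; apply: filterS FS => h Sh.
    exact: (QS (f, h)).
  apply: filterS Fe => f /= fF x.
  apply: (@cvgr_to_le _ F _ _ (fun h : D => `|h x - f x|)).
    by apply: cvg_norm; apply: cvgB; [exact: Fx|exact: cvg_cst].
  apply: filterS fF => h /ev - /(_ x).
  by rewrite -ball_normE /= distrC => /ltW.
have cg : continuous g.
  move=> x; apply/(@cvgrPdist_le _ _ _ (nbhs x)) => e e0.
  have e3 : 0 < e / 3 by rewrite divr_gt0.
  have [f gf] := filter_ex (Fg _ e3).
  have /cvgrPdist_le/(_ _ e3) fx := @cts_fun _ _ f x; apply: filterS fx => y fy.
  rewrite (_ : g x - g y = (g x - f x) + (f x - f y) - (g y - f y)); last first.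
    by rewrite addrA subrK opprB addrA subrK.
  rewrite (le_trans (ler_normB _ _))// (le_trans (lerD (ler_normD _ _) (lexx _)))//.
  have -> : e = e / 3 + e / 3 + e / 3.
    by lra.
  by rewrite !lerD.
apply/cvg_ex; exists (mkcts cg : D); apply/cvgrPdist_le => e e0; have Fe := Fg _ e0.
apply: filterS Fe => f gf; apply: sup_norm_le; last exact: gf.
exact: ltW.
Qed.

HB.instance Definition _ := Uniform_isComplete.Build D D_complete.

(* f on Delta a b, 0 elsewhere; it is only ever integrated over Delta a b. *)
Definition extension (f : D) : R -> R := 'valL_0 f.

Lemma extension_in f (x : R) (xD : Delta a b x) :
  extension f x = f (SigSub (mem_set xD)).
Proof. exact: (congr1 (@^~ (SigSub (mem_set xD))) (valLK 0 f)). Qed.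

Lemma extension_out f (x : R) : ~ Delta a b x -> extension f x = 0.
Proof.
move=> xD; have := congr1 (fun k => k (extension f) x) (@sigLK _ _ 0 (Delta a b)).
by rewrite /= valLK patchE memNset.
Qed.

Lemma extension_bound f x : `|extension f x| <= sup_norm f.
Proof.
have [xD|xD] := pselect (Delta a b x).
  by rewrite (extension_in f xD) sup_norm_ub.
by rewrite extension_out// normr0 sup_norm_ge0.
Qed.

Lemma extension_within f : {within Delta a b, continuous (extension f)}.
Proof. by apply/subspace_valL_continuousP'; exact: cts_fun. Qed.

Lemma extension_linear (c : R) f g x :
  extension (c *: f + g) x = c * extension f x + extension g x.
Proof.
have [xD|xD] := pselect (Delta a b x).
  by rewrite !(extension_in _ xD) D_addE D_scaleE.
by rewrite !extension_out// mulr0 addr0.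
Qed.

Lemma measurable_Delta : measurable (Delta a b).
Proof.
rewrite Delta_bigsetU; apply: bigsetU_measurable => k _.
exact: measurable_itv.
Qed.

Lemma extension_measurable f : measurable_fun setT (extension f).
Proof.
rewrite (_ : extension f = extension f \_ (Delta a b)).
  apply/(measurable_restrictT _ measurable_Delta).
  apply: subspace_continuous_measurable_fun; first exact: measurable_Delta.
  exact: extension_within.
apply/funext => x; rewrite patchE; case: ifPn => // /negP xD.
by rewrite extension_out// => /mem_set.
Qed.

Lemma extension_continuous f (x : R) : (forall k, x != a k /\ x != b k) ->
  {for x, continuous (extension f)}.
Proof.
move=> xab; have [[k _ kx]|xD] := pselect (Delta a b x).
  have [xa xb] := xab k.
  have kx' : x \in `]a k, b k[.
    move: kx; rewrite /= !in_itv/= => /andP[ax xb'].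
    by rewrite !lt_neqAle ax xb' xb eq_sym xa.
  have nD : nbhs x (Delta a b).
    apply: filterS (near_in_itvoo kx') => y; rewrite inE/= => ky.
    by exists k => //=; exact: subset_itv_oo_cc ky.
  have := @extension_within f x.
  by rewrite /continuous_at -(nbhs_subspace_interior nD).
have nD : nbhs x (~` Delta a b).
  apply: open_nbhs_nbhs; split => //; rewrite openC.
  by apply: compact_closed; [exact: Rhausdorff|exact: compact_Delta].
apply: cvg_near_cst; apply: filterS nD => y yD.
by rewrite !extension_out.
Qed.

End D_Delta_lmod.

Section measures.
Variables (R : realType) (nu : {measure set (measurableTypeR R) -> \bar R}).

Definition nonzero_measure : Prop :=
  exists2 A : set (measurableTypeR R), measurable A & nu A != 0%E.

Definition levy_measure : Prop :=
  nu [set 0] = 0%E /\ (\int[nu]_x (Num.min 1 (x ^+ 2))%:E < +oo)%E.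

Definition summable_measure : Prop := (nu [set: R] < +oo)%E.

Definition total_mass : R := fine (nu [set: R]).

Definition continuous_measure : Prop := forall x : R, nu [set x] = 0%E.

(* [fine] sends +oo to 0: meaningful for a summable nu only. *)
Definition distribution_function (x : R) : R := fine (nu `]-oo, x]%classic).

Definition unimodal_mode0 : Prop :=
  convex_function (`]-oo, 0[%classic : set R) distribution_function /\
  convex_function (`]0, +oo[%classic : set R) (\- distribution_function).

End measures.

Section generator.
Variables (R : realType) (n : nat) (a b : 'I_n -> R).
Variable nu : {measure set (measurableTypeR R) -> \bar R}.
Local Notation D := (D_Delta a b).
Implicit Types f g : D.

(* The drift gamma = int_{|y| < 1} y nu(dy) cancels the compensator of the Levy
   generator, which leaves int (f(x + u) - f(x)) nu(du); truncation to Delta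
   only affects the term in f(x + u). *)
Definition generator_fun f (x : Delta a b) : R :=
  - total_mass nu * f x +
  \int[nu]_(u in [set u : R | Delta a b (\val x + u)]) extension f (\val x + u).

Hypothesis nu_fin : summable_measure nu.
Hypothesis nu_cont : continuous_measure nu.

Lemma integrable_shift f x :
  nu.-integrable setT (EFin \o (fun u => extension f (x + u))).
Proof.
apply: measurable_bounded_integrable => //.
  apply: measurableT_comp; first exact: extension_measurable.
  exact: measurable_funD.
exists (sup_norm f); split=> [|M fM u _]; first exact: num_real.
by apply: le_trans (ltW fM); exact: extension_bound.
Qed.

Lemma measurable_shift_Delta (x : R) :
  measurable ([set u | Delta a b (x + u)] : set (measurableTypeR R)).
Proof.
rewrite -[X in measurable X]setTI.
have mx : measurable_fun [set: measurableTypeR R] (fun u : R => x + u).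
  exact: measurable_funD.
by apply: mx => //; exact: measurable_Delta.
Qed.

Lemma shift_ae (x c : R) : {ae nu, forall u : measurableTypeR R, x + u != c}.
Proof.
exists [set c - x]; split; [exact: measurable_set1|exact: nu_cont|].
move=> u /= /negP; rewrite negbK => /eqP <-.
by rewrite addrC addKr.
Qed.

Lemma generator_funE f x : generator_fun f x =
  - total_mass nu * f x + \int[nu]_u extension f (\val x + u).
Proof.
congr (_ + _); rewrite Rintegral_mkcond; apply: eq_Rintegral => u _.
rewrite patchE; case: ifPn => // /negP xu; rewrite extension_out// => xu'.
by apply: xu; rewrite inE.
Qed.

Lemma shift_continuous f : continuous (fun x : R => \int[nu]_u extension f (x + u)).
Proof.
move=> x; apply/(@cvg_nbhsP _ R^o) => w wx; apply: fine_cvg.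
have intx := integrable_shift f x.
rewrite fineK; last exact: integrable_fin_num.
have intc : nu.-integrable setT (EFin \o cst (sup_norm f)).
  apply: measurable_bounded_integrable => //.
  exists (sup_norm f); split=> [|M fM u _]; first exact: num_real.
  by rewrite /= ger0_norm ?sup_norm_ge0// ltW.
have wxu : {ae nu, forall u, setT u ->
    (extension f (w k + u))%:E @[k --> \oo] --> (extension f (x + u))%:E}.
  have : {ae nu, forall u : measurableTypeR R,
      forall k, x + u != a k /\ x + u != b k}.
    by apply: filter_forall => k; apply: filterI; exact: shift_ae.
  apply: filterS => u xu _; apply: cvg_EFin; first exact: nearW.
  have := @extension_continuous _ _ _ _ f _ xu.
  move/(@cvg_nbhsP _ R^o); apply; apply: cvgD wx _; exact: cvg_cst.
have wb : {ae nu, forall u k, setT u ->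
    (`|(extension f (w k + u))%:E| <= (EFin \o cst (sup_norm f)) u)%E}.
  by apply: aeW => u k _; rewrite lee_fin; exact: extension_bound.
have [] // := dominated_convergence measurableT _ (measurable_int _ intx) wxu intc wb.
by move=> k; exact: measurable_int (integrable_shift f (w k)).
Qed.

Lemma generator_continuous f : continuous (generator_fun f).
Proof.
have -> : generator_fun f = (fun x => - total_mass nu * f x) \+
    ((fun x : R => \int[nu]_u extension f (x + u)) \o set_val).
  by apply/funext => x; rewrite /= generator_funE.
move=> x; have cf : {for x, continuous (fun x => - total_mass nu * f x)}.
  by apply: continuousM; [exact: cst_continuous|exact: cts_fun].
have cg : {for x, continuous
    ((fun x : R => \int[nu]_u extension f (x + u)) \o set_val)}.
  by apply: continuous_comp; [exact: initial_continuous|exact: shift_continuous].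
exact: (continuousD cf cg).
Qed.

Definition L_Delta f : D := mkcts (@generator_continuous f).

Lemma L_DeltaE f x : L_Delta f x = generator_fun f x.
Proof. by []. Qed.

Lemma L_Delta_linear : linear L_Delta.
Proof.
move=> c f g; apply/D_eqP => x.
rewrite D_addE D_scaleE !L_DeltaE !generator_funE.
rewrite (_ : \int[nu]_u extension (c *: f + g) (\val x + u) =
    c * \int[nu]_u extension f (\val x + u) +
    \int[nu]_u extension g (\val x + u)).
  by rewrite D_addE D_scaleE; ring.
rewrite -RintegralZl//; last exact: integrable_shift.
rewrite -RintegralD//; last 2 first.
- exact: (integrableZl measurableT c (integrable_shift f (\val x))).
- exact: integrable_shift.
apply: eq_Rintegral => u _; exact: extension_linear.
Qed.

HB.instance Definition _ := GRing.isLinear.Build R D D *:%R L_Delta L_Delta_linear.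

End generator.

Definition compact_operator (R : realType) (V W : normedModType R)
    (T : V -> W) : Prop :=
  forall B : set V, bounded_set B -> precompact (T @` B).

Definition is_inverse_operator (R : realType) (V : normedModType R)
    (L M : {linear V -> V}) : Prop :=
  [/\ continuous M, cancel L M & cancel M L].

(* Main.v *)
From HB Require Import structures.
Require Import Defs.
From mathcomp Require Import all_boot all_order all_algebra.
From mathcomp Require Import all_classical all_reals all_analysis.
From mathcomp Require Import measurable_realfun ring lra.

Set Implicit Arguments.
Unset Strict Implicit.
Unset Printing Implicit Defensive.

Import Order.TTheory GRing.Theory Num.Theory.
Import numFieldNormedType.Exports.

Local Open Scope classical_set_scope.
Local Open Scope ring_scope.

(** Put [Omega = nu(R)] and let [S f (x) = Omega^-1 int f(x + u) nu(du)], with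
    [f] extended by zero outside [Delta]. Then [L_Delta = - Omega (I - S)], so
    the theorem says that [I - S] is invertible with inverse [N = I + S N], and
    that [T1 = S N] is compact. Two facts about [S] give this.

    Invertibility. The norm of [S] may be 1 (when the jumps are short compared
    to [Delta]), but [S] contracts a weighted sup norm. As [nu] is not zero,
    jumps of size at least [d] in one of the two directions, say [s = 1] or
    [s = -1], have positive mass. For the weight [w x = C - exp (lam s x)] with
    [lam] and [C] large, such a jump either leaves [Delta] or lands where [w] is
    so much smaller that on average [w] decreases by a fixed factor [q < 1]
    ([jump_operator_weight]). Hence [|S^k| <= C q^k] and the Neumann series
    [sum_k S^k] converges ([neumann_series]).

    Compactness. By Arzela-Ascoli ([precompact_equicontinuous_bounded]) it is
    enough that [S] maps bounded sets to equicontinuous ones, which amounts to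
    the translates of [nu] depending continuously on the shift in total
    variation. This is where unimodality enters: away from the mode the
    distribution function [F] is concave or convex, so moving an interval away
    from the mode can only decrease its mass. The part of [nu] on one side of
    the mode therefore dominates its outward translate, and the difference is a
    positive measure, whose total variation is just the mass lost by
    translating ([stieltjes_decomposition], [shifted_integralB]). Adding the
    contributions of both sides, translating by [h] changes integrals of
    functions bounded by [M] by at most [2 M (F h - F (- h))]
    ([unimodal_translation]), which tends to 0 because [nu] has no atom. *)

(** * Neumann series and precompactness *)

Lemma ultra_image_cvg (T : Type) (U : topologicalType) (F : set_system T)
    (h : T -> U) (K : set U) :
  UltraFilter F -> compact K -> F (h @^-1` K) -> exists2 p, K p & h @ F --> p.
Proof.
move=> FU cK FK; have [p [Kp hp]] := cK (h @ F) _ FK.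
exists p => // A pA.
have [//|FA] := in_ultra_setVsetC (h @^-1` A) FU.
by have [y [nAy Ay]] := hp (~` A) A FA pA.
Qed.

(** Only the growth of the powers is bounded, because the norm of [S] itself may
    be 1. Both identities come from the same sequence: the partial sums of
    [S (N f)] and of [N (S f)] are those of [N f] without their first term. *)
Lemma neumann_series (R : realType) (V : completeNormedModType R)
    (S : {linear V -> V}) (C q : R) :
  0 <= q < 1 -> (forall k f, `|iter k S f| <= C * q ^+ k * `|f|) ->
  exists N : {linear V -> V}, [/\ continuous N,
    forall f, N f - S (N f) = f & forall f, N (f - S f) = f].
Proof.
move=> /andP[q0 q1] Sk.
have nq1 : `|q| < 1 by rewrite ger0_norm.
pose u f : V ^nat := fun k => iter k S f.
have cS : continuous S.
  apply: bounded_linear_continuous; apply/linear_boundedP.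
  exists (C * q); split=> [|r rC f]; first exact: num_real.
  by apply: le_trans (Sk 1%N f) _; rewrite expr1 ler_wpM2r// ltW.
have le_norm f n : [normed series (u f)] n <= series (geometric (C * `|f|) q) n.
  by apply: ler_sum => k _; rewrite /= mulrAC; exact: Sk.
have cn f : cvgn [normed series (u f)].
  apply: (@series_le_cvg _ (fun k => `|u f k|) (geometric (C * `|f|) q)).
  - by move=> k; exact: normr_ge0.
  - by move=> k; rewrite /= mulrAC (le_trans _ (Sk k f)).
  - by move=> k; rewrite /= mulrAC; exact: Sk.
  - exact: is_cvg_geometric_series.
have cu f : cvgn (series (u f)) by exact: normed_cvg.
pose N f := limn (series (u f)).
have Nlin : linear N.
  move=> c f g; apply/cvg_lim; first exact: norm_hausdorff.
  have -> : series (u (c *: f + g)) =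
      (fun n => c *: series (u f) n + series (u g) n).
    apply/funext => n; rewrite /series/= scaler_sumr -big_split/=.
    apply: eq_bigr => k _; rewrite /u.
    by elim: k => //= k ->; rewrite linearP.
  by apply: cvgD; [apply: cvgZr; exact: cu|exact: cu].
have NS f : series (u f) n - f @[n --> \oo] --> N f - f.
  by apply: cvgB; [exact: cu|exact: cvg_cst].
have sub_head f : (fun n => series (u f) n.+1 - f) = series (u (S f)).
  apply/funext => n; rewrite /series/= big_nat_recl//= addrAC subrr add0r.
  by apply: eq_bigr => k _; rewrite /u -iterSr.
have NS1 f : series (u (S f)) n @[n --> \oo] --> N f - f.
  by rewrite -sub_head; have := NS f; rewrite -cvg_shiftS.
have SN f : S (N f) = N f - f.
  have h1 : S \o series (u f) @ \oo --> S (N f).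
    by apply: continuous_cvg; [exact: cS|exact: cu].
  apply: (cvg_unique _ h1); first exact: norm_hausdorff.
  have -> : S \o series (u f) = series (u (S f)).
    apply/funext => n; rewrite /series/= linear_sum; apply: eq_bigr => k _.
    by rewrite /u -iterSr.
  exact: NS1.
have NSf f : N (S f) = N f - f.
  apply/cvg_lim; first exact: norm_hausdorff.
  exact: NS1.
pose Nl : {linear V -> V} := HB.pack N (GRing.isLinear.Build R V V *:%R N Nlin).
exists Nl; split=> [|f|f].
- apply: bounded_linear_continuous; apply/linear_boundedP.
  exists (C / (1 - q)); split=> [|r rC f]; first exact: num_real.
  apply: le_trans (lim_series_norm (cn f)) _.
  have : limn [normed series (u f)] <= limn (series (geometric (C * `|f|) q)).
    apply: ler_lim (cn f) (is_cvg_geometric_series nq1) _.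
    by apply: nearW => n; exact: le_norm.
  move=> /le_trans; apply; rewrite (cvg_lim _ (cvg_geometric_series nq1))//.
  by rewrite mulrAC ler_wpM2r// ltW.
- by rewrite /= SN opprB addrC subrK.
- by rewrite linearB/= NSf opprB addrC subrK.
Qed.

(** Arzela-Ascoli with a uniform modulus of continuity [w]. Along an ultrafilter
    the values at each point converge, as they stay in a segment; the limit
    inherits the bound and the modulus, and the modulus makes the convergence
    locally uniform, hence uniform since [Delta] is compact. *)
Lemma precompact_equicontinuous_bounded (R : realType) (n : nat)
    (a b : 'I_n -> R) (A : set (D_Delta a b)) (M : R) (w : R -> R) :
  w t @[t --> 0] --> 0 ->
  (forall f, A f -> forall x, `|f x| <= M) ->
  (forall f, A f -> forall x y, `|f x - f y| <= w (\val x - \val y)) ->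
  precompact A.
Proof.
move=> w0 Ab Aw.
pose K : set (D_Delta a b) := [set f | (forall x, `|f x| <= M) /\
  forall x y, `|f x - f y| <= w (\val x - \val y)].
have AK : A `<=` K by move=> f Af; split; [exact: Ab|exact: Aw].
apply: precompact_subset AK _.
apply: compact_precompact; first exact: norm_hausdorff.
rewrite compact_ultra => F FU FK.
have evF x : exists p : R, (fun f : D_Delta a b => f x) @ F --> p.
  have [|p _ ?] := @ultra_image_cvg _ _ _ (fun f : D_Delta a b => f x)
    `[- M, M]%classic FU (@segment_compact R (- M) M); last by exists p.
  by apply: filterS FK => f [fM _]; rewrite /= in_itv/= -ler_norml.
have [g Fg] := choice evF.
have gM x : `|g x| <= M.
  apply: (@cvgr_to_le _ F _ _ (fun h : D_Delta a b => `|h x|)).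
    by apply: cvg_norm; exact: Fg.
  by apply: filterS FK => f [].
have gw x y : `|g x - g y| <= w (\val x - \val y).
  apply: (@cvgr_to_le _ F _ _ (fun h : D_Delta a b => `|h x - h y|)).
    by apply: cvg_norm; apply: cvgB; exact: Fg.
  by apply: filterS FK => f [].
have near_w (x : Delta a b) e : 0 < e ->
    \forall y \near x, w (\val x - \val y) <= e.
  move=> e0.
  have xy : \val x - \val y @[y --> x] --> (0 : R).
    rewrite -[X in _ --> X](subrr (\val x)).
    apply: (@cvgB _ _ _ (nbhs x)); first exact: cvg_cst.
    exact: (@initial_continuous _ _ (@set_val R (Delta a b)) x).
  have := cvg_comp _ _ xy w0 => /cvgrPdist_le/(_ _ e0).
  by apply: filterS => y /=; rewrite sub0r normrN => /ler_normlW.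
have cg : continuous g.
  move=> x; apply/(@cvgrPdist_le _ _ _ (nbhs x)) => e e0.
  by apply: filterS (near_w x _ e0) => y; exact: le_trans (gw x y).
pose G : D_Delta a b := mkcts cg.
exists G; split; first by split.
apply/cvgrPdist_le => e e0.
have e3 : 0 < e / 3 by rewrite divr_gt0.
have : F [set f : D_Delta a b |
    [set: Delta a b] `<=` (fun x => `|g x - f x| <= e)].
  move/compact_near_coveringP : (@compact_DeltaT R n a b) => ncD.
  apply: (ncD _ F (fun (f : D_Delta a b) x => `|g x - f x| <= e)) => x _.
  exists ([set y | w (\val x - \val y) <= e / 3],
          [set f | K f /\ `|g x - f x| <= e / 3]).
    split; first exact: near_w.
    by apply: filterI => //; have /cvgrPdist_le/(_ _ e3) := Fg x.
  move=> [y f] [wy [[_ fw] gf]].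
  move: wy fw gf => /= wy fw gf.
  have gy := le_trans (gw x y) wy; have fy := le_trans (fw x y) wy.
  rewrite (_ : g y - f y = - (g x - g y) + (g x - f x) + (f x - f y)).
    2: by ring.
  apply: le_trans (ler_normD _ _) _.
  rewrite (_ : e = e / 3 + e / 3 + e / 3); last by lra.
  by rewrite lerD// (le_trans (ler_normD _ _))// normrN lerD.
apply: filterS => f fe; apply: sup_norm_le; first exact: ltW.
by move=> x; exact: fe.
Qed.

(** * Bounded integrands and distribution functions *)

Lemma finite_measure_fin_num (d : measure_display) (T : measurableType d)
    (R : realType) (mu : {measure set T -> \bar R}) (A : set T) :
  (mu setT < +oo)%E -> measurable A -> mu A \is a fin_num.
Proof.
move=> muT mA; rewrite ge0_fin_numE//; apply: le_lt_trans muT.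
by apply: le_measure; rewrite ?inE.
Qed.

Lemma bounded_integrable (d : measure_display) (T : measurableType d)
    (R : realType) (mu : {measure set T -> \bar R}) (A : set T) (M : R)
    (g : T -> R) :
  (mu setT < +oo)%E -> measurable A -> measurable_fun setT g ->
  (forall u, `|g u| <= M) -> mu.-integrable A (EFin \o g).
Proof.
move=> muT mA mg gM; apply: measurable_bounded_integrable => //.
- by rewrite -ge0_fin_numE// finite_measure_fin_num.
- exact: measurable_funTS.
- exists M; split=> [|r Mr u _]; first exact: num_real.
  exact: le_trans (gM u) (ltW Mr).
Qed.

Lemma Rintegral_le_cst (d : measure_display) (T : measurableType d)
    (R : realType) (mu : {measure set T -> \bar R}) (A : set T) (M : R)
    (g : T -> R) :
  (mu setT < +oo)%E -> measurable A -> mu.-integrable A (EFin \o g) ->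
  (forall u, A u -> `|g u| <= M) -> `|\int[mu]_(u in A) g u| <= M * fine (mu A).
Proof.
move=> muT mA ig gM.
apply: le_trans (le_normr_Rintegral mA ig) _.
rewrite -Rintegral_cst//; apply: le_Rintegral => //.
- exact: (integrable_norm ig).
- apply: (@bounded_integrable _ _ _ _ _ `|M|) => //.
Qed.

Lemma distribution_functionB (R : realType)
    (mu : {measure set (measurableTypeR R) -> \bar R}) (p q : R) :
  (mu setT < +oo)%E -> p <= q ->
  fine (mu `]p, q]%classic) =
    distribution_function mu q - distribution_function mu p.
Proof.
move=> muT pq; rewrite /distribution_function.
rewrite (@itv_bndbnd_setU _ _ -oo%O (BRight p) (BRight q))//.
rewrite measureU//; last first.
  apply/seteqP; split => // u [] /=; rewrite !in_itv/= => up /andP[pu _].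
  by move: (lt_le_trans pu up); rewrite ltxx.
have fm A : measurable A -> mu A \is a fin_num.
  exact: finite_measure_fin_num.
by rewrite fineD ?fm// [X in _ = X - _]addrC addrK.
Qed.

(** [F t] is the integral of the indicator of [`]-oo, t]], and these indicators
    converge at every [u != x] as [t] tends to [x]; as [x] is not an atom,
    dominated convergence applies. *)
Lemma distribution_function_continuous (R : realType)
    (mu : {measure set (measurableTypeR R) -> \bar R}) :
  (mu setT < +oo)%E -> continuous_measure mu ->
  continuous (distribution_function mu).
Proof.
move=> muT muc.
pose g t (u : measurableTypeR R) : R := \1_`]-oo, t] u.
have mg t : measurable_fun setT (g t) by exact: measurable_indic.
have g1 t u : `|g t u| <= 1.
  by rewrite /g indicE; case: (_ \in _); rewrite ?normr1// normr0.
have intE t : distribution_function mu t = \int[mu]_u g t u.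
  by rewrite /distribution_function /Rintegral integral_indic// setIT.
rewrite (_ : distribution_function mu = (fun t => \int[mu]_u g t u)).
  2: exact/funext.
move=> x; apply/(@cvg_nbhsP _ R^o) => w wx.
have int t := bounded_integrable muT measurableT (mg t) (g1 t).
apply: fine_cvg; rewrite fineK; last exact: integrable_fin_num (int x).
have int1 : mu.-integrable setT (EFin \o cst (1%R : R)).
  by apply: (@bounded_integrable _ _ _ _ _ 1) => // u; rewrite normr1.
have wxu : {ae mu, forall u, setT u ->
    (g (w k) u)%:E @[k --> \oo] --> (g x u)%:E}.
  exists [set x]; split; [exact: measurable_set1|exact: muc|].
  move=> u /=; apply: contraPP => /eqP; rewrite neq_lt => ux H; apply: H => _.
  apply: cvg_near_cst.
  have [ux'|xu'] := orP ux.
    have : \forall k \near \oo, u < w k by exact: (cvgr_gt x wx).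
    apply: filterS => k uw.
    by rewrite /g !indicE !mem_set//= in_itv/= ltW.
  have : \forall k \near \oo, w k < u by exact: (cvgr_lt x wx).
  apply: filterS => k uw.
  by rewrite /g !indicE !memNset//= in_itv/= ; apply/negP; rewrite -ltNge.
have wb : {ae mu, forall u k, setT u ->
    (`|(g (w k) u)%:E| <= (EFin \o cst (1%R : R)) u)%E}.
  by apply: aeW => u k _; rewrite lee_fin.
have [] // :=
  dominated_convergence measurableT _ (measurable_int _ (int x)) wxu int1 wb.
by move=> k; exact: measurable_int (int (w k)).
Qed.

(** * Measures compared on intervals *)

Lemma lebesgue_stieltjes_measure_itv (R : realType) (f : cumulative R R)
    (p q : R) : p <= q ->
  lebesgue_stieltjes_measure f `]p, q]%classic = (f q - f p)%:E.
Proof.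
move=> pq; rewrite /lebesgue_stieltjes_measure /measure_extension/=.
rewrite measurable_mu_extE/=; last exact: is_ocitv.
by rewrite wlength_itv_bnd.
Qed.

Lemma measurable_itvR (R : realType) (i : interval R) :
  measurable ([set` i] : set (measurableTypeR R)).
Proof. exact: measurable_itv. Qed.

(** The difference of the distribution functions is nondecreasing and
    continuous, so it is the distribution function of a Stieltjes measure [l].
    Thus an inequality on half-open intervals yields a decomposition on all
    Borel sets. *)
Lemma stieltjes_decomposition (R : realType)
    (m1 m2 : {measure set (measurableTypeR R) -> \bar R}) :
  (m1 setT < +oo)%E -> (m2 setT < +oo)%E ->
  continuous_measure m1 -> continuous_measure m2 ->
  (forall p q, p <= q -> (m2 `]p, q]%classic <= m1 `]p, q]%classic)%E) ->
  exists l : {measure set (measurableTypeR R) -> \bar R},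
    forall A, measurable A -> m1 A = (l A + m2 A)%E.
Proof.
move=> m1T m2T m1c m2c m21.
pose G x := distribution_function m1 x - distribution_function m2 x.
have fm1 A : measurable A -> m1 A \is a fin_num by exact: finite_measure_fin_num.
have fm2 A : measurable A -> m2 A \is a fin_num by exact: finite_measure_fin_num.
have GB p q : p <= q ->
    G q - G p = fine (m1 `]p, q]%classic) - fine (m2 `]p, q]%classic).
  by move=> pq; rewrite !distribution_functionB// /G; ring.
have Gnd : nondecreasing G.
  move=> p q pq; rewrite -subr_ge0 GB// subr_ge0 fine_le ?fm1 ?fm2//.
  exact: m21.
have Grc : right_continuous G.
  apply: right_continuousW => x.
  by apply: cvgB; exact: distribution_function_continuous.
pose Gc : cumulative R R := HB.pack G (isCumulative.Build R _ R G Gnd Grc).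
pose l := lebesgue_stieltjes_measure Gc.
exists l => A mA.
have := @measure_unique _ R (measurableTypeR R) (@ocitv R)
  (fun k => `](- k%:R), k%:R]%classic) erefl (@ocitvI R) (fun k => is_ocitv _ _) _
  m1 (measure_add l m2) _ _ A mA.
move=> H; rewrite -(measure_addE l m2); apply: H.
- apply/seteqP; split=> // u _.
  exists (Num.bound `|u|) => //=; rewrite in_itv/=.
  have := archi_boundP (normr_ge0 u); rewrite ltr_norml => /andP[bu ub].
  by apply/andP; split; [exact: bu|exact: ltW].
- move=> _ [[p q] _ <-] /=.
  transitivity (l `]p, q]%classic + m2 `]p, q]%classic)%E; last first.
    by rewrite -(measure_addE l m2).
  have [pq|qp] := leP p q; last first.
    rewrite set_itv_ge; last by rewrite bnd_simp -leNgt ltW.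
    by rewrite !measure0 adde0.
  rewrite [X in (X + _)%E](_ : _ = (G q - G p)%:E); last first.
    exact: (lebesgue_stieltjes_measure_itv Gc).
  by rewrite GB// EFinB !fineK ?fm1 ?fm2 ?subeK ?fm2//; exact: measurable_itvR.
- move=> k; by rewrite -ge0_fin_numE// fm1//; exact: measurable_itvR.
Qed.

(** The integrals differ by the integral against the positive measure
    [mu1 - mu2] on [Z], whose total mass is [mu1 Z - mu2 Z]. *)
Lemma dominated_integralB (R : realType)
    (mu1 mu2 : {measure set (measurableTypeR R) -> \bar R})
    (Z : set (measurableTypeR R)) (M : R) (g : measurableTypeR R -> R) :
  (mu1 setT < +oo)%E -> (mu2 setT < +oo)%E ->
  continuous_measure mu1 -> continuous_measure mu2 -> measurable Z ->
  (forall p q, p <= q ->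
    (mu2 (Z `&` `]p, q]%classic) <= mu1 (Z `&` `]p, q]%classic))%E) ->
  measurable_fun setT g -> (forall u, `|g u| <= M) ->
  `|\int[mu1]_(u in Z) g u - \int[mu2]_(u in Z) g u| <=
    M * (fine (mu1 Z) - fine (mu2 Z)).
Proof.
move=> m1T m2T m1c m2c mZ m21 mg gM.
pose m1 := mrestr mu1 mZ; pose m2 := mrestr mu2 mZ.
have mu1Z A : A `<=` Z -> mu1 A = m1 A by move=> AZ; rewrite /m1 /mrestr setIidl.
have mu2Z A : A `<=` Z -> mu2 A = m2 A by move=> AZ; rewrite /m2 /mrestr setIidl.
have [l m1E] : exists l : {measure set (measurableTypeR R) -> \bar R},
    forall A, measurable A -> m1 A = (l A + m2 A)%E.
  apply: stieltjes_decomposition => [|||| p q pq].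
  - by rewrite /= /mrestr setTI -ge0_fin_numE// finite_measure_fin_num.
  - by rewrite /= /mrestr setTI -ge0_fin_numE// finite_measure_fin_num.
  - move=> x; apply: (@subset_measure0 _ _ _ mu1 _ [set x]).
    + by apply: measurableI => //; exact: measurable_set1.
    + exact: measurable_set1.
    + exact: subIsetl.
    + exact: m1c.
  - move=> x; apply: (@subset_measure0 _ _ _ mu2 _ [set x]).
    + by apply: measurableI => //; exact: measurable_set1.
    + exact: measurable_set1.
    + exact: subIsetl.
    + exact: m2c.
  - by rewrite /= /mrestr !(setIC _ Z); exact: m21.
have lT : (l setT < +oo)%E.
  apply: (@le_lt_trans _ _ (m1 setT)); first by rewrite m1E// leeDl.
  by rewrite /m1 /mrestr -ge0_fin_numE// finite_measure_fin_num// setTI.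
have fm2 : fine (mu1 Z) - fine (mu2 Z) = fine (l Z).
  rewrite mu1Z// mu2Z// m1E// fineD ?addrK//; first exact: finite_measure_fin_num.
  by rewrite -mu2Z// finite_measure_fin_num.
have intl := bounded_integrable lT mZ mg gM.
have int2 := bounded_integrable m2T mZ mg gM.
suff -> : \int[mu1]_(u in Z) g u - \int[mu2]_(u in Z) g u = \int[l]_(u in Z) g u.
  by rewrite fm2; apply: Rintegral_le_cst.
apply/eqP; rewrite subr_eq; apply/eqP; rewrite /Rintegral.
rewrite (@eq_measure_integral _ _ _ _ (measure_add l m2)); last first.
  by move=> A mA AZ; rewrite mu1Z// m1E//; exact/esym/measure_addE.
rewrite [in RHS](@eq_measure_integral _ _ _ _ m2 mu2); last first.
  by move=> A mA AZ; exact: mu2Z.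
have int3 : m2.-integrable Z (EFin \o g).
  apply: (@bounded_integrable _ _ _ m2 _ M) => //.
  by rewrite /= /mrestr setTI -ge0_fin_numE// finite_measure_fin_num.
rewrite integral_measure_add//.
by rewrite fineD//; [exact: integrable_fin_num|exact: integrable_fin_num].
Qed.

(** * Translations of a unimodal measure *)

(** [mu (tau @^-1` A)] is the mass that [mu] gives to [A + d]: the comparison is
    between [mu] on [Z] and the part of [mu] on [Z + d] brought back to [Z]. *)
Lemma shifted_integralB (R : realType)
    (mu : {measure set (measurableTypeR R) -> \bar R})
    (Z : set (measurableTypeR R)) (d M : R) (g : measurableTypeR R -> R)
    (tau := (fun u => u - d) : measurableTypeR R -> measurableTypeR R) :
  (mu setT < +oo)%E -> continuous_measure mu -> measurable Z ->
  (forall p q, p <= q ->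
    (mu (tau @^-1` (Z `&` `]p, q]%classic)) <= mu (Z `&` `]p, q]%classic))%E) ->
  measurable_fun setT g -> (forall u, `|g u| <= M) ->
  `|\int[mu]_(u in Z) g u - \int[mu]_(u in tau @^-1` Z) g (tau u)| <=
    M * (fine (mu Z) - fine (mu (tau @^-1` Z))).
Proof.
move=> muT muc mZ dom mg gM.
have mtau : measurable_fun setT tau by exact: measurable_funB.
have mtauZ : measurable (tau @^-1` Z).
  by rewrite -[X in measurable X]setTI; exact: mtau.
have [mu2 mu2E] : exists m : {measure set (measurableTypeR R) -> \bar R},
    m = pushforward mu tau :> (set (measurableTypeR R) -> \bar R).
  by unshelve eexists (pushforward mu tau :
    {measure set (measurableTypeR R) -> \bar R}).
have mu2c : continuous_measure mu2.
  move=> x; rewrite mu2E /pushforward (_ : _ @^-1` _ = [set x + d]); first exact: muc.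
  apply/seteqP; split=> u /=; rewrite /tau; first by move/(canRL (subrK d)).
  by move=> ->; rewrite addrK.
have mu2T : (mu2 setT < +oo)%E by rewrite mu2E.
have dom2 p q : p <= q ->
    (mu2 (Z `&` `]p, q]%classic) <= mu (Z `&` `]p, q]%classic))%E.
  by rewrite mu2E; exact: dom.
have := dominated_integralB muT mu2T muc mu2c mZ dom2 mg gM.
rewrite {1}/Rintegral [X in _ - X]/Rintegral mu2E.
congr (`|_ - fine _| <= _).
apply: integral_pushforward => //; first exact/measurable_EFinP.
apply: (@bounded_integrable _ _ _ mu _ M (g \o tau)) => [//|//||u].
  exact: measurableT_comp.
exact: gM.
Qed.

(** Both [q] and [p + h] lie on the segment from [p] to [q + h], with
    complementary barycentric coordinates; add the two convexity
    inequalities. *)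
Lemma convex_function_shift (R : realType) (E : set R) (F : R -> R) (p q h : R) :
  convex_function (E : set (convex_lmodType R^o)) F -> E p -> E (q + h) ->
  p <= q -> 0 <= h -> F q + F (p + h) <= F p + F (q + h).
Proof.
move=> cF Ep Eqh pq h0; have [pqE|pq'] := eqVneq p q; first by rewrite pqE.
have {pq pq'}pq : p < q by rewrite lt_neqAle pq' pq.
have D0 : 0 < q + h - p by rewrite subr_gt0 ltr_wpDr.
pose c := h / (q + h - p).
have c0 : 0 <= c by rewrite divr_ge0 // ltW.
have c1 : c <= 1 by rewrite ler_pdivrMr// mul1r; lra.
have cvx t : 0 <= t -> t <= 1 ->
    F (t * p + (1 - t) * (q + h)) <= t * F p + (1 - t) * F (q + h).
  by move=> t0 t1; exact: (cF (Itv01 t0 t1) p (q + h) (mem_set Ep) (mem_set Eqh)).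
have := cvx c c0 c1; have := cvx (1 - c).
rewrite subr_ge0 gerBl => /(_ c1 c0).
have -> : (1 - c) * p + (1 - (1 - c)) * (q + h) = p + h.
  by rewrite /c; field; rewrite gt_eqF.
have -> : c * p + (1 - c) * (q + h) = q by rewrite /c; field; rewrite gt_eqF.
by lra.
Qed.

(** Intervals to the right of the mode lose mass when moved further right. The
    boundary case [p = 0], where concavity of [F] is not assumed, follows by
    continuity of [F]. *)
Lemma distribution_function_shift_right (R : realType)
    (nu : {measure set (measurableTypeR R) -> \bar R}) (p q h : R)
    (F := distribution_function nu) :
  summable_measure nu -> continuous_measure nu -> unimodal_mode0 nu ->
  0 <= p -> p <= q -> 0 <= h -> F (q + h) - F (p + h) <= F q - F p.
Proof.
move=> nu_fin nu_cont [_ cF] p0 pq h0.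
have cts : continuous F by exact: distribution_function_continuous.
have pos t : 0 < t -> t <= q -> F (q + h) - F (t + h) <= F q - F t.
  move=> t0 tq.
  have := @convex_function_shift _ _ _ t q h cF; rewrite /= !in_itv/= !andbT.
  move=> /(_ t0 (ltr_wpDr h0 (lt_le_trans t0 tq)) tq h0).
  by rewrite -/F; lra.
move: p0; rewrite le_eqVlt => /orP[/eqP p0|p0]; last exact: pos.
move: pq; rewrite -p0 le_eqVlt => /orP[/eqP <-|q0]; first by rewrite !subrr.
have lim0 : F q - F t - (F (q + h) - F (t + h)) @[t --> 0^'+] -->
    F q - F 0 - (F (q + h) - F (0 + h)).
  apply: cvg_at_right_filter.
  have cth : {for 0, continuous (fun t => F (t + h))}.
    apply: (@continuous_comp _ _ _ (fun t => t + h)); last exact: cts.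
    by apply: cvgD; [exact: cvg_id|exact: cvg_cst].
  apply: (@cvgB _ _ _ (nbhs (0 : R))).
    by apply: (@cvgB _ _ _ (nbhs (0 : R))); [exact: cvg_cst|exact: cts].
  by apply: (@cvgB _ _ _ (nbhs (0 : R))); [exact: cvg_cst|exact: cth].
rewrite -subr_ge0; apply: (cvgr_to_ge lim0).
near=> t; rewrite subr_ge0; apply: pos => //.
near: t; exact: nbhs_right_le.
Unshelve. all: by end_near. Qed.

Lemma distribution_function_shift_left (R : realType)
    (nu : {measure set (measurableTypeR R) -> \bar R}) (p q h : R)
    (F := distribution_function nu) :
  summable_measure nu -> continuous_measure nu -> unimodal_mode0 nu ->
  q <= 0 -> p <= q -> 0 <= h -> F (q - h) - F (p - h) <= F q - F p.
Proof.
move=> nu_fin nu_cont [cF _] q0 pq h0.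
have cts : continuous F by exact: distribution_function_continuous.
have neg t : t < 0 -> p <= t -> F (t - h) - F (p - h) <= F t - F p.
  move=> t0 pt.
  have := @convex_function_shift _ _ _ (p - h) (t - h) h cF.
  rewrite /= !in_itv/= !subrK.
  move=> /(_ _ t0 _ h0); rewrite lerB// -/F => H.
  have : p - h < 0 by lra.
  by move=> /H /(_ isT); lra.
move: q0; rewrite le_eqVlt => /orP[/eqP q0|q0]; last exact: neg.
move: pq; rewrite q0 le_eqVlt => /orP[/eqP <-|p0]; first by rewrite !subrr.
have lim0 : F t - F p - (F (t - h) - F (p - h)) @[t --> 0^'-] -->
    F 0 - F p - (F (0 - h) - F (p - h)).
  apply: cvg_at_left_filter.
  have cth : {for 0, continuous (fun t => F (t - h))}.
    apply: (@continuous_comp _ _ _ (fun t => t - h)); last exact: cts.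
    by apply: cvgB; [exact: cvg_id|exact: cvg_cst].
  apply: (@cvgB _ _ _ (nbhs (0 : R))).
    by apply: (@cvgB _ _ _ (nbhs (0 : R))); [exact: cts|exact: cvg_cst].
  by apply: (@cvgB _ _ _ (nbhs (0 : R))); [exact: cth|exact: cvg_cst].
rewrite -subr_ge0; apply: (cvgr_to_ge lim0).
near=> t; rewrite subr_ge0; apply: neg => //.
near: t; exact: nbhs_left_ge.
Unshelve. all: by end_near. Qed.

Lemma Rintegral_itv_split (R : realType)
    (nu : {measure set (measurableTypeR R) -> \bar R}) (x y : itv_bound R)
    (c : R) (g : measurableTypeR R -> R) :
  nu.-integrable setT (EFin \o g) -> (x <= BRight c)%O -> (BRight c <= y)%O ->
  \int[nu]_(u in [set` Interval x y]) g u =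
  \int[nu]_(u in [set` Interval x (BRight c)]) g u +
  \int[nu]_(u in [set` Interval (BRight c) y]) g u.
Proof.
move=> ig xc cy; rewrite (@itv_bndbnd_setU _ _ x (BRight c) y)//.
rewrite Rintegral_setU//; try exact: measurable_itvR.
  apply: integrableS ig => //; apply: measurableU; exact: measurable_itvR.
apply/disj_setPS => u [] /=; rewrite !itv_boundlr => /andP[_ uc] /andP[cu _].
by move: uc cu; rewrite !bnd_simp leNgt => /negP.
Qed.

(** Pair the mass on [`]0, +oo[] with that on [`]h, +oo[], and the mass on
    [`]-oo, 0]] with that on [`]-oo, -h]], so that both times the measure on the
    larger half-line dominates its outward translate. What is left unpaired is
    carried by [`]-h, 0]] and [`]0, h]]. *)
Lemma unimodal_translation (R : realType)
    (nu : {measure set (measurableTypeR R) -> \bar R}) (h M : R)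
    (k : measurableTypeR R -> R) (F := distribution_function nu) :
  summable_measure nu -> continuous_measure nu -> unimodal_mode0 nu ->
  0 <= h -> measurable_fun setT k -> (forall u, `|k u| <= M) ->
  `|\int[nu]_u k u - \int[nu]_u k (u + h)| <= 2 * M * (F h - F (- h)).
Proof.
move=> nu_fin nu_cont nu_uni h0 mk kM.
pose kh (u : measurableTypeR R) := k (u + h).
have mkh : measurable_fun setT kh.
  by apply: measurableT_comp => //; exact: measurable_funD.
have khM u : `|kh u| <= M by exact: kM.
have ik : nu.-integrable setT (EFin \o k).
  exact: bounded_integrable nu_fin measurableT mk kM.
have ikh : nu.-integrable setT (EFin \o kh).
  exact: bounded_integrable nu_fin measurableT mkh khM.
have hN0 : - h <= 0 by rewrite oppr_le0.
have FB p q : p <= q -> fine (nu `]p, q]%classic) = F q - F p.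
  exact: distribution_functionB.
have fin A : measurable A -> nu A \is a fin_num by exact: finite_measure_fin_num.
have right : `|\int[nu]_(u in `]0, +oo[) kh u - \int[nu]_(u in `]h, +oo[) k u|
    <= M * (F h - F 0).
  have tau_pre : (fun u : measurableTypeR R => u - h) @^-1` `]0, +oo[%classic =
      `]h, +oo[%classic.
    by apply/seteqP; split=> u; rewrite /= !in_itv/= !andbT subr_gt0.
  have dom (p q : R) : p <= q ->
      (nu ((fun u : measurableTypeR R => (u - h)%R) @^-1`
        (`]0%R, +oo[ `&` `]p, q]%classic)) <=
       nu (`]0%R, +oo[ `&` `]p, q]%classic))%E.
    move=> _; set r := Num.max 0 p.
    have -> : `]0, +oo[ `&` `]p, q] = `]r, q]%classic :> set R.
      apply/seteqP; split=> u; rewrite /= !in_itv/= andbT gt_max.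
        by move=> [-> /andP[-> ->]].
      by move=> /andP[/andP[-> ->] ->].
    have -> : (fun u => u - h) @^-1` `]r, q]%classic = `](r + h), (q + h)]%classic.
      by apply/seteqP; split=> u; rewrite /= !in_itv/= ltrBrDr lerBlDr.
    have [rq|qr] := leP r q; last first.
      by rewrite !set_itv_ge ?measure0// bnd_simp -leNgt ?lerD2r ltW.
    rewrite -[leLHS]fineK ?fin//.
    rewrite -[leRHS]fineK ?fin//.
    rewrite lee_fin !FB ?lerD2r//.
    by apply: distribution_function_shift_right => //; rewrite le_max lexx.
  have := shifted_integralB nu_fin nu_cont (measurable_itvR `]0, +oo[) dom mkh khM.
  rewrite tau_pre (_ : fine (nu _) - fine (nu _) = F h - F 0).
    by congr (`|_ - _| <= _); apply: eq_Rintegral => u _; rewrite /kh subrK.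
  rewrite -(FB 0 h)// (@itv_bndbnd_setU _ _ (BRight 0) (BRight h) +oo%O)//.
  rewrite measureU ?fineD ?fin ?addrK//; try exact: measurable_itvR.
  apply/seteqP; split=> // u []; rewrite /= !in_itv/= andbT => /andP[_ uh].
  by rewrite ltNge uh.
have left : `|\int[nu]_(u in `]-oo, 0]) k u - \int[nu]_(u in `]-oo, (- h)]) kh u|
    <= M * (F 0 - F (- h)).
  have tau_pre : (fun u : measurableTypeR R => u - - h) @^-1` `]-oo, 0%R]%classic =
      `]-oo, (- h)%R]%classic.
    by apply/seteqP; split=> u; rewrite /= !in_itv/= opprK -[- h]sub0r lerBrDr.
  have dom (p q : R) : p <= q ->
      (nu ((fun u : measurableTypeR R => (u - - h)%R) @^-1`
        (`]-oo, 0%R] `&` `]p, q]%classic)) <=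
       nu (`]-oo, 0%R] `&` `]p, q]%classic))%E.
    move=> _; set r := Num.min 0 q.
    have -> : `]-oo, 0] `&` `]p, q] = `]p, r]%classic :> set R.
      apply/seteqP; split=> u; rewrite /= !in_itv/= le_min.
        by move=> [-> /andP[-> ->]].
      by move=> /andP[-> /andP[-> ->]].
    have -> : (fun u => u - - h) @^-1` `]p, r]%classic = `](p - h), (r - h)]%classic.
      by apply/seteqP; split=> u; rewrite /= !in_itv/= opprK ltrBlDr lerBrDr.
    have [pr|rp] := leP p r; last first.
      by rewrite !set_itv_ge ?measure0// bnd_simp -leNgt ?lerD2r ltW.
    rewrite -[leLHS]fineK ?fin//.
    rewrite -[leRHS]fineK ?fin//.
    rewrite lee_fin !FB ?lerD2r//.
    by apply: distribution_function_shift_left => //; rewrite ge_min lexx.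
  have := shifted_integralB nu_fin nu_cont (measurable_itvR `]-oo, 0]) dom mk kM.
  rewrite tau_pre; congr (`|_ - _| <= _).
  by apply: eq_Rintegral => u _; rewrite opprK.
have midr : `|\int[nu]_(u in `]0, h]) k u| <= M * (F h - F 0).
  by rewrite -FB//; apply: Rintegral_le_cst => //; exact: (integrableS measurableT).
have midl : `|\int[nu]_(u in `](- h), 0]) kh u| <= M * (F 0 - F (- h)).
  by rewrite -FB//; apply: Rintegral_le_cst => //; exact: (integrableS measurableT).
rewrite -set_itvNyy.
rewrite (Rintegral_itv_split (c := 0) ik)// (Rintegral_itv_split (c := 0) ikh)//.
rewrite (@Rintegral_itv_split _ _ (BRight 0) +oo%O h k ik)//.
rewrite (@Rintegral_itv_split _ _ -oo%O (BRight 0) (- h) kh ikh)//.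
move: right left midr midl; rewrite !ler_norml.
move=> /andP[? ?] /andP[? ?] /andP[? ?] /andP[? ?]; apply/andP; split; lra.
Qed.

(** * The normalised jump operator *)

Lemma measurable_mulr_preimage (R : realType) (s : R) (i : interval R) :
  measurable (( *%R s : R -> R) @^-1` [set` i] : set (measurableTypeR R)).
Proof.
rewrite -[X in measurable X]setTI.
have mf : measurable_fun (setT : set (measurableTypeR R)) (fun u : R => s * u).
  exact: measurable_funM.
by apply: mf => //; exact: measurable_itv.
Qed.

(** The origin and the sets of jumps of size at least [1/k] to the right, or to
    the left, cover the line, so they cannot all be negligible. *)
Lemma large_jump (R : realType)
    (nu : {measure set (measurableTypeR R) -> \bar R}) :
  nu [set 0] = 0%E -> (0 < nu setT)%E ->
  exists s d : R, [/\ `|s| = 1, 0 < d &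
    (0 < nu (( *%R s : R -> R) @^-1` `[d, +oo[%classic))%E].
Proof.
move=> nu0 nuT; apply: contrapT => H.
have small (s d : R) : `|s| = 1 -> 0 < d ->
    nu.-negligible (( *%R s : R -> R) @^-1` `[d, +oo[%classic).
  move=> s1 d0; apply/negligibleP; first exact: measurable_mulr_preimage.
  apply/eqP; rewrite eq_le measure_ge0 andbT leNgt; apply/negP => nud.
  by apply: H; exists s, d.
have : nu.-negligible (setT : set (measurableTypeR R)).
  rewrite (_ : setT = [set 0] `|`
    \bigcup_k (( *%R 1 : R -> R) @^-1` `[k.+1%:R^-1, +oo[%classic) `|`
    \bigcup_k (( *%R (-1) : R -> R) @^-1` `[k.+1%:R^-1, +oo[%classic)).
    apply: negligibleU; first apply: negligibleU.
    - by apply/negligibleP => //; exact: measurable_set1.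
    - by apply: negligible_bigcup => k; apply: small; rewrite ?normr1.
    - by apply: negligible_bigcup => k; apply: small; rewrite ?normrN ?normr1.
  apply/seteqP; split=> // u _.
  have ex (v : R) : 0 < v -> exists k, k.+1%:R^-1 <= v.
    move=> v0; exists (Num.bound v^-1); rewrite invf_ple// ?posrE//.
    have := archi_boundP (ltW (_ : 0 < v^-1)); rewrite invr_gt0 => /(_ v0) vb.
    by apply: ltW; apply: lt_trans vb _; rewrite ltr_nat.
  have [u0|u0|->] := ltgtP u 0; last by left; left.
  - have [|k ku] := ex (- u); first by rewrite oppr_gt0.
    by right; exists k => //; rewrite /= in_itv/= andbT mulN1r.
  - have [k ku] := ex u u0.
    by left; right; exists k => //; rewrite /= in_itv/= andbT mul1r.
move/negligibleP => /(_ measurableT) nu1; by move: nuT; rewrite nu1 ltxx.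
Qed.

Section jump_operator.
Variables (R : realType) (n : nat) (a b : 'I_n -> R).
Variable nu : {measure set (measurableTypeR R) -> \bar R}.
Hypotheses (nu_fin : summable_measure nu) (nu_cont : continuous_measure nu).
Hypothesis mass_gt0 : 0 < total_mass nu.
Local Notation D := (D_Delta a b).
Local Notation Omega := (total_mass nu).

(** Defined from [L_Delta], so that it inherits continuity and linearity; it is
    the normalised jump kernel by [jump_operatorE]. *)
Definition jump_operator (f : D) : D := Omega^-1 *: L_Delta nu_fin nu_cont f + f.

Lemma jump_operator_linear : linear jump_operator.
Proof.
move=> c f g; rewrite /jump_operator linearP !scalerDr !scalerA addrACA.
by rewrite mulrC.
Qed.
HB.instance Definition _ :=
  GRing.isLinear.Build R D D *:%R jump_operator jump_operator_linear.

Lemma jump_operatorE f x : jump_operator f x =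
  Omega^-1 * \int[nu]_u extension f (\val x + u).
Proof.
rewrite /jump_operator D_addE D_scaleE L_DeltaE generator_funE//.
by field; rewrite gt_eqF.
Qed.

Lemma integrable_extension_shift (f : D) (x : R) (A : set (measurableTypeR R)) :
  measurable A -> nu.-integrable A (EFin \o (fun u => extension f (x + u))).
Proof. by move=> mA; apply: integrableS (integrable_shift nu_fin f x). Qed.

Lemma jump_operator_bound (f : D) (M : R) :
  (forall x, `|f x| <= M) -> forall x, `|jump_operator f x| <= M.
Proof.
move=> fM x; rewrite jump_operatorE normrM gtr0_norm ?invr_gt0//.
rewrite ler_pdivrMl// mulrC; apply: Rintegral_le_cst => //.
  exact: integrable_extension_shift.
move=> u _; apply: le_trans (extension_bound f _) _.
apply: sup_norm_le => //; exact: le_trans (fM x).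
Qed.

Lemma jump_operator_modulus (f : D) (M : R) (F := distribution_function nu) :
  unimodal_mode0 nu -> (forall x, `|f x| <= M) ->
  forall x y, `|jump_operator f x - jump_operator f y| <=
    Omega^-1 * (2 * M * (F `|\val x - \val y| - F (- `|\val x - \val y|))).
Proof.
move=> nu_uni fM x y.
wlog yx : x y / \val y <= \val x.
  move=> H; have [/H//|/ltW/H] := leP (\val y) (\val x).
  by rewrite distrC (distrC (\val y)).
have h0 : 0 <= \val x - \val y by rewrite subr_ge0.
rewrite (ger0_norm h0) !jump_operatorE -mulrBr normrM gtr0_norm ?invr_gt0//.
rewrite ler_pM2l ?invr_gt0// distrC.
pose k (u : measurableTypeR R) := extension f (\val y + u).
have mk : measurable_fun setT k.
  apply: measurableT_comp; first exact: extension_measurable.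
  exact: measurable_funD.
have kM u : `|k u| <= M.
  apply: le_trans (extension_bound f _) _; apply: sup_norm_le => //.
  exact: le_trans (fM x).
have := unimodal_translation nu_fin nu_cont nu_uni h0 mk kM.
congr (`|_ - _| <= _); apply: eq_Rintegral => u _.
by rewrite /k; congr (extension f _); ring.
Qed.

(** The modulus [w] comes from [jump_operator_modulus] and tends to 0 at 0 since
    the distribution function is continuous. *)
Lemma compact_jump_operator :
  unimodal_mode0 nu -> compact_operator jump_operator.
Proof.
move=> nu_uni B [M0 [_ BM0]].
pose M := `|M0| + 1.
have BM f : B f -> forall x, `|f x| <= M.
  move=> Bf x; apply: le_trans (sup_norm_ub f x) _; apply: (BM0 M) Bf.
  by rewrite /M (le_lt_trans (ler_norm _))// ltrDl.
pose F := distribution_function nu.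
pose w (t : R) : R := Omega^-1 * (2 * M * (F `|t| - F (- `|t|))).
apply: (@precompact_equicontinuous_bounded _ _ _ _ _ M w).
- rewrite [X in _ --> X](_ : 0 = w 0); last first.
    by rewrite /w normr0 oppr0 subrr !mulr0.
  have cF : continuous F by exact: distribution_function_continuous.
  have c1 : {for 0, continuous (fun t : R => F `|t|)}.
    apply: (@continuous_comp _ _ _ (fun t : R => `|t|)); last exact: cF.
    exact: norm_continuous.
  have c2 : {for 0, continuous (fun t : R => F (- `|t|))}.
    apply: (@continuous_comp _ _ _ (fun t : R => - `|t|)); last exact: cF.
    by apply: continuousN; exact: norm_continuous.
  have c3 : {for 0, continuous (fun t : R => F `|t| - F (- `|t|))}.
    exact: (continuousB c1 c2).
  have cc (c : R) : {for 0, continuous (fun _ : R => c)}.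
    by move=> ?; exact: cvg_cst.
  exact: (continuousM (cc Omega^-1) (continuousM (cc (2 * M)) c3)).
- by move=> _ [f Bf <-]; apply: jump_operator_bound; exact: BM.
- by move=> _ [f Bf <-]; apply: jump_operator_modulus => //; exact: BM.
Qed.

End jump_operator.

(** Contraction of a weighted norm. With [e x = exp (lam s x)] and
    [w = C - e], a jump with [s u >= d] multiplies [e] by at least
    [exp (lam d)], or exits, where [f] vanishes; any other jump gives at most
    [C]. If [p] is the mass of the former jumps, averaging bounds [S f] by
    [N (C - e exp (lam d) p / Omega)], and [lam] is chosen so that this is at
    most [N (C - 2 e)]; since [e] is bounded below by [m > 0] on [Delta], this
    is at most [q N (C - e)] with [q = 1 - m / C]. *)
Lemma jump_operator_weight (R : realType) (n : nat) (a b : 'I_n -> R)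
    (nu : {measure set (measurableTypeR R) -> \bar R})
    (nu_fin : summable_measure nu) (nu_cont : continuous_measure nu) :
  0 < total_mass nu ->
  exists (w : R -> R) (C q : R), [/\ 0 <= q < 1,
    forall x, Delta a b x -> 1 <= w x <= C &
    forall (f : D_Delta a b) (N : R), 0 <= N ->
      (forall x, `|f x| <= N * w (\val x)) ->
      forall x, `|jump_operator nu_fin nu_cont f x| <= q * N * w (\val x)].
Proof.
move=> mass_gt0; set Omega := total_mass nu.
have massE : nu setT = Omega%:E by rewrite fineK// finite_measure_fin_num.
have [||s [d [s1 d0 nuA]]] := @large_jump _ nu; first exact: nu_cont.
  by rewrite massE lte_fin.
pose A : set (measurableTypeR R) := ( *%R s : R -> R) @^-1` `[d, +oo[%classic.
have mA : measurable A by exact: measurable_mulr_preimage.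
pose p := fine (nu A).
have pE : nu A = p%:E by rewrite fineK// finite_measure_fin_num.
have p0 : 0 < p by move: nuA; rewrite -/A pE lte_fin.
have [L [L0 DL]] : exists L : R, 0 <= L /\ forall x, Delta a b x -> `|s * x| <= L.
  have /compact_bounded[L0 [_ DL]] := @compact_Delta R n a b.
  exists (`|L0| + 1); split=> [|x Dx]; first by rewrite addr_ge0.
  rewrite normrM s1 mul1r; apply: (DL (`|L0| + 1)) => //.
  by rewrite (le_lt_trans (ler_norm _))// ltrDl.
(* Since [exp t >= 1 + t], this value gives [p exp (lam d) >= 2 Omega]. *)
pose lam := 2 * Omega / (p * d).
have lam0 : 0 < lam by rewrite divr_gt0 ?mulr_gt0.
have jump_gain : 2 * Omega <= p * expR (lam * d).
  rewrite -ler_pdivrMl//; apply: le_trans (expR_ge1Dx _).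
  rewrite (_ : lam * d = p^-1 * (2 * Omega)) ?lerDr//.
  by rewrite /lam; field; rewrite !gt_eqF.
(* Large enough that [w >= 1] on [Delta] and that the bound [C - E] for large
   jumps is nonnegative, as needed when they leave [Delta]. *)
pose C := expR (lam * (L + d)) + 1.
pose m := expR (- (lam * L)).
pose e (x : R) := expR (lam * (s * x)).
pose w x := C - e x.
have m0 : 0 < m by exact: expR_gt0.
have m1 : m <= 1 by rewrite -expR0 ler_expR oppr_le0 mulr_ge0 // ltW.
have C1 : 1 < C by rewrite /C ltrDr expR_gt0.
have C0 : 0 < C by exact: lt_trans C1.
have em x : Delta a b x -> m <= e x.
  move=> /DL; rewrite ler_norml => /andP[Lx _].
  by rewrite /m /e ler_expR -mulrN ler_pM2l.
have eC x : Delta a b x -> e x * expR (lam * d) <= C - 1.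
  move=> /DL; rewrite ler_norml => /andP[_ xL].
  by rewrite /e /C addrK -expRD ler_expR -mulrDr ler_pM2l// lerD2r.
have ed1 : 1 <= expR (lam * d) by rewrite -expR0 ler_expR mulr_ge0 ?ltW.
exists w, C, (1 - m / C); split.
- rewrite subr_ge0 ler_pdivrMr// mul1r gtrBl divr_gt0// andbT.
  exact: le_trans m1 (ltW C1).
- move=> x Dx; have := eC x Dx; have := em x Dx.
  rewrite /w => ? ?; apply/andP; split; last by lra.
  have : e x <= e x * expR (lam * d) by rewrite ler_peMr// expR_ge0.
  by lra.
move=> f N N0 fw x.
have Dx : Delta a b (\val x) by exact: set_valP.
set E := e (\val x) * expR (lam * d).
have EC : E <= C by have := eC _ Dx; rewrite -/E; lra.
(* [E] bounds [e] from below after a large jump that stays in [Delta]. *)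
have fA u : A u -> `|extension f (\val x + u)| <= N * (C - E).
  rewrite /A /= in_itv/= andbT => du.
  have [Dxu|Dxu] := pselect (Delta a b (\val x + u)); last first.
    by rewrite extension_out// normr0 mulr_ge0// subr_ge0.
  rewrite (extension_in f Dxu); apply: le_trans (fw _) _.
  rewrite ler_wpM2l// lerB// /E /e -expRD ler_expR -mulrDr ler_pM2l//.
  by rewrite mulrDr lerD2l.
have fAC u : (~` A) u -> `|extension f (\val x + u)| <= N * C.
  move=> _.
  have [Dxu|Dxu] := pselect (Delta a b (\val x + u)); last first.
    by rewrite extension_out// normr0 mulr_ge0// ltW.
  rewrite (extension_in f Dxu); apply: le_trans (fw _) _.
  by rewrite ler_wpM2l// gerBl expR_ge0.
rewrite jump_operatorE// normrM gtr0_norm ?invr_gt0// ler_pdivrMl//.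
rewrite -(setUv A) Rintegral_setU//; last 3 first.
- exact: measurableC.
- by rewrite setUv; exact: integrable_extension_shift.
- by apply/disj_setPS; rewrite setICr.
have nuAC : fine (nu (~` A)) = Omega - p.
  rewrite /Omega /total_mass -(setUv A) measureU ?setICr//; last exact: measurableC.
  rewrite fineD ?finite_measure_fin_num//; last exact: measurableC.
  by rewrite /p [X in X - _]addrC addrK.
apply: le_trans (ler_normD _ _) _.
have iA := integrable_extension_shift nu_fin f (\val x) mA.
have iAC := integrable_extension_shift nu_fin f (\val x) (measurableC mA).
apply: le_trans (lerD (Rintegral_le_cst nu_fin mA iA fA)
  (Rintegral_le_cst nu_fin (measurableC mA) iAC fAC)) _.
rewrite nuAC -/p (_ : _ + _ = N * (C * Omega - p * E)); last by ring.
rewrite (_ : Omega * _ = N * (Omega * ((1 - m / C) * w (\val x)))); last by ring.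
rewrite ler_wpM2l//.
have eO : e (\val x) * (2 * Omega) <= p * E.
  by rewrite /E [leRHS]mulrCA ler_pM2l// expR_gt0.
rewrite (_ : C * Omega - p * E = Omega * C - p * E); last by ring.
apply: (@le_trans _ _ (Omega * (C - 2 * e (\val x)))).
  by move: eO; set z := e (\val x); nra.
rewrite ler_pM2l// /w -subr_ge0.
rewrite (_ : _ - _ = (e (\val x) - m) + m / C * e (\val x)); last first.
  by field; rewrite gt_eqF.
apply: addr_ge0; first by rewrite subr_ge0 em.
by rewrite mulr_ge0 ?divr_ge0 ?expR_ge0// ltW.
Qed.

(** The weight [w] lies between 1 and [C], so the weighted norm is equivalent to
    the sup norm. *)
Lemma jump_operator_iter (R : realType) (n : nat) (a b : 'I_n -> R)
    (nu : {measure set (measurableTypeR R) -> \bar R})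
    (nu_fin : summable_measure nu) (nu_cont : continuous_measure nu) :
  0 < total_mass nu ->
  exists C q : R, 0 <= q < 1 /\ forall k (f : D_Delta a b),
    `|iter k (jump_operator nu_fin nu_cont) f| <= C * q ^+ k * `|f|.
Proof.
move=> mass_gt0.
have [w [C [q [q01 w1C Sw]]]] :=
  @jump_operator_weight _ _ a b _ nu_fin nu_cont mass_gt0.
have q0 : 0 <= q by case/andP: q01.
exists `|C|, q; split=> // k f.
have Dx (x : Delta a b) : Delta a b (\val x) by exact: set_valP.
have Sk x : `|iter k (jump_operator nu_fin nu_cont) f x| <=
    q ^+ k * `|f| * w (\val x).
  elim: k x => [|k IH] x.
    have /andP[w1 _] := w1C _ (Dx x).
    rewrite /= mul1r; apply: le_trans (sup_norm_ub f x) _.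
    by rewrite ler_peMr// sup_norm_ge0.
  rewrite iterS exprS -(mulrA q); apply: Sw => //.
  by rewrite mulr_ge0 ?exprn_ge0.
apply: sup_norm_le => [|x]; first by rewrite !mulr_ge0 ?exprn_ge0.
apply: le_trans (Sk x) _; rewrite -(mulrA `|C|) [leRHS]mulrC.
rewrite ler_wpM2l ?mulr_ge0 ?exprn_ge0//.
have /andP[_ wC] := w1C _ (Dx x).
exact: le_trans wC (ler_norm _).
Qed.

(** * The inverse *)

Unset Implicit Arguments.

Theorem proposition1p12 (R : realType) (n : nat) (a b : 'I_n -> R)
    (nu : {measure set (measurableTypeR R) -> \bar R})
    (n_gt0 : (0 < n)%N) (ab : interlaced a b)
    (nu_levy : levy_measure nu) (nu_neq0 : nonzero_measure nu)
    (nu_cont : continuous_measure nu) (nu_fin : summable_measure nu)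
    (nu_unimodal : unimodal_mode0 nu) :
  exists Linv : {linear D_Delta a b -> D_Delta a b},
    is_inverse_operator (L_Delta nu_fin nu_cont) Linv /\
    exists T1 : {linear D_Delta a b -> D_Delta a b},
      compact_operator T1 /\
      forall f, Linv f = - (total_mass nu)^-1 *: (f + T1 f).
Proof.
have mass_gt0 : 0 < total_mass nu.
  have [A mA nuA] := nu_neq0.
  rewrite lt0r fine_ge0// andbT; apply/eqP => nu0; move/eqP: nuA; apply.
  apply: (@subset_measure0 _ _ _ nu A setT) => //.
  by rewrite -[LHS]fineK ?finite_measure_fin_num// -/(total_mass nu) nu0.
set Omega := total_mass nu in mass_gt0 *.
have Omega0 : Omega != 0 by rewrite gt_eqF.
pose S : {linear D_Delta a b -> D_Delta a b} := jump_operator nu_fin nu_cont.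
have LE f : L_Delta nu_fin nu_cont f = - Omega *: (f - S f).
  rewrite /S /= /jump_operator opprD addrCA subrr addr0 scalerN scaleNr opprK.
  by rewrite scalerA divff// scale1r.
have [C [q [q01 Sk]]] := @jump_operator_iter _ _ a b _ nu_fin nu_cont mass_gt0.
have [N [cN NS SN]] := @neumann_series R (D_Delta a b) S C q q01 Sk.
pose Linv : {linear D_Delta a b -> D_Delta a b} := - Omega^-1 \*: N.
exists Linv; split; first split.
- move=> f; apply: (@cvgZr _ _ _ (nbhs f)); exact: cN.
- move=> f; transitivity (Linv (- Omega *: (f - S f))).
    by congr (Linv _); exact: LE.
  rewrite /Linv /= linearZ/= SN scalerA mulrNN mulVf// scale1r //.
- move=> f; transitivity (- Omega *: (Linv f - S (Linv f))); first exact: LE.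
  rewrite /Linv /= linearZ/= -scalerBr NS scalerA mulrNN divff// scale1r //.
exists (S \o N); split; last first.
  by move=> f; rewrite /Linv/= -{2}(NS f) subrK.
move=> B bB.
have bNB : bounded_set (N @` B).
  have [r [_ Br]] := bB.
  have bN : bounded_near N (nbhs (0 : D_Delta a b)).
    exact/linear_bounded_continuous.
  have [M NM] := iffRL (bounded_funP N) bN (r + 1).
  exists M; split=> [|t Mt _ [f Bf <-]]; first exact: num_real.
  apply: le_trans (ltW Mt); apply: NM.
  by apply: (Br (r + 1)) Bf; rewrite ltrDl.
have := @compact_jump_operator _ _ a b _ nu_fin nu_cont mass_gt0 nu_unimodal _ bNB.
apply: precompact_subset => _ [f Bf <-] /=.
by exists (N f) => //; exists f.
Qed.
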